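(* The distribution functions $F_\infty^{(1)},\ldots,F_\infty^{(N)}$ satisfy $$F_\infty^{(j)}(n)=\sum_{k=m_j}^{n}p_k^{(j)}\,F_\infty^{(j+1)}(n-k),\qquad j=1,2,\ldots,N,\quad n\in\mathbb Z,\ n\ge M_j,$$ where $F_\infty^{(N+1)}=F_\infty^{(1)}$. Also $$F_\infty^{(j)}(n+m_j)=\sum_{k=0}^{n}\pi_k^{(j+1)}F_{X_j}(m_j+n-k),\qquad j=1,2,\ldots,N,\quad n\in\mathbb Z,\ n\ge0,$$ where $\pi^{(N+1)}=\pi^{(1)}$.
   Context: Let $N\in\mathbb N$ and let $X_1,X_2,\ldots$ be independent integer-valued random variables that are $N$-periodic in distribution: $X_k$ and $X_{k+N}$ have the same distribution for all $k\in\mathbb N$. For $j=1,\ldots,N$ the support of $X_j$ starts at $m_j\in\mathbb Z$, i.e. $\mathbb P(X_j=m_j)>0$ and $\mathbb P(X_j\ge m_j)=1$, and $m_1+\cdots+m_N<0$ (the individual $m_j$ may have any sign). Extend $m_{i+N}=m_i$ for all $i\in\mathbb N$ and set $$M_j:=\max\{m_j,\,m_j+m_{j+1},\,\ldots,\,m_j+m_{j+1}+\cdots+m_{j+N-1}\},\quad j=1,\ldots,N.$$ Notation: $p^{(j)}_k:=\mathbb P(X_j=k)$, $F_{X_j}(k):=\mathbb P(X_j\le k)$ for $k\in\mathbb Z$; $$F_\infty^{(j)}(x):=\mathbb P\Big(\sup_{n\ge j}\sum_{k=j}^nX_k\le x\Big),\quad x\in\mathbb Z;$$ $\mathcal M_j:=\max\{0,\,X_j,\,X_j+X_{j+1},\,X_j+X_{j+1}+X_{j+2},\ldots\}$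 (supremum over all partial sums started at index $j$) and $\pi^{(j)}_k:=\mathbb P(\mathcal M_j=k)$ for $k\in\mathbb N_0=\{0,1,2,\ldots\}$. Empty sums are $0$. *)

(* Defs.v *)
From HB Require Import structures.
From mathcomp Require Import all_boot all_order all_algebra finmap.
From mathcomp Require Import all_classical all_reals all_analysis.

Set Implicit Arguments.
Unset Strict Implicit.
Unset Printing Implicit Defensive.

Import Order.TTheory GRing.Theory Num.Theory.

Local Open Scope classical_set_scope.
Local Open Scope ring_scope.

(* As for [nat] and [bool] in the library, every set of integers is
   measurable; integer-valued random variables are [{RV P >-> int}]. *)
HB.instance Definition _ := isPointed.Build int 0.
HB.instance Definition _ := @isMeasurable.Build default_measure_display
  int discrete_measurable discrete_measurable0
  discrete_measurableC discrete_measurableU.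

Definition mutually_independent (d d' : measure_display)
    (T : measurableType d) (T' : measurableType d') (R : realType)
    (P : probability T R) (I : choiceType) (D : set I)
    (X : I -> {RV P >-> T'}) : Prop :=
  forall (J : {fset I}) (A : I -> set T'),
    [set` J] `<=` D ->
    (forall i, i \in J -> measurable (A i)) ->
    P (\bigcap_(i in [set` J]) (X i @^-1` A i)) =
      (\prod_(i <- J) P (X i @^-1` A i))%E.

Section Periodic_random_walk.
Context (d : measure_display) (T : measurableType d) (R : realType)
  (P : probability T R).
Implicit Types (X : nat -> {RV P >-> int}) (m : nat -> int).

(* Sequences are indexed from 1: the value at index 0 is never used. *)

Definition prob_mass X (j : nat) (k : int) : R :=
  fine (P [set w | X j w = k]).

Definition dist_fun X (j : nat) (k : int) : R :=
  fine (P [set w | X j w <= k]).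

Definition partial_sums X (j : nat) (w : T) : set (\bar R) :=
  [set ((\sum_(j <= k < n.+1) X k w)%:~R)%:E | n in [set n | (j <= n)%N]].

(* The suprema are taken in [\bar R], since no drift condition
   ensures that they are finite. *)
Definition F_infty X (j : nat) (x : int) : R :=
  fine (P [set w | (ereal_sup (partial_sums X j w) <= (x%:~R)%:E)%E]).

Definition calM X (j : nat) (w : T) : \bar R :=
  ereal_sup ([set 0%E] `|` partial_sums X j w).

Definition pi_mass X (j k : nat) : R :=
  fine (P [set w | calM X j w = (k%:R)%:E]).

End Periodic_random_walk.

(* The default value [m j] of the iterated maximum is its term [l = 0]. *)
Definition M_bound (N : nat) (m : nat -> int) (j : nat) : int :=
  \big[Order.max/m j]_(0 <= l < N) \sum_(j <= i < j + l.+1) m i.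

(* Main.v *)
(** Splitting on the first step, with the gap [i = x - X_a] as a natural number,
    decomposes the event that all partial sums from [a] stay below [x] into a
    countable disjoint union of events [{X_a = x - i}] intersected with the same
    event for [a + 1] and level [i].  For finitely many partial sums, iterating
    this reduces independence from the past, and [N]-periodicity of the
    probability, to product formulas for finitely many [X_k]; both pass to the
    limit.  The series for [F_infty] becomes the first formula because
    [X_j >= m_j] a.s.; the second follows from it by summation by parts, as
    [F_infty j.+1] at a natural number is the cumulative sum of [pi_mass j.+1]. *)
Require Import Defs.
From mathcomp Require Import all_boot all_order all_algebra finmap zify.
From mathcomp Require Import all_classical all_reals all_analysis.

Set Implicit Arguments.
Unset Strict Implicit.
Unset Printing Implicit Defensive.

Import Order.TTheory GRing.Theory Num.Theory.

Local Open Scope classical_set_scope.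
Local Open Scope ring_scope.

(** * Events keeping partial sums below a level, and their probabilities *)

Section StayBelow.
Context (d : measure_display) (T : measurableType d) (R : realType)
  (P : probability T R) (X : nat -> {RV P >-> int}).

(** The horizon [t] counts the constrained sums: [t = 0] gives the whole space, and one step of the
    walk trades [a, t.+1] for [a.+1, t]. *)
Definition stay_below (a t : nat) (x : int) : set T :=
  [set w | forall s, (s < t)%N -> \sum_(a <= k < (a + s).+1) X k w <= x].

Definition stay_below_forever (a : nat) (x : int) : set T :=
  \bigcap_t stay_below a t x.

Lemma measurable_preimage j (A : set int) : measurable (X j @^-1` A).
Proof. by rewrite -[X in measurable X]setTI; exact: measurable_funPT. Qed.

(* Conditioning on the gap [x - X a] rather than on [X a] makes the index a
   natural number without using that [X a] is bounded below. *)
Lemma stay_below_rec a t x :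
  stay_below a t.+1 x =
  \bigcup_i (X a @^-1` [set x - i%:Z] `&` stay_below a.+1 t i%:Z).
Proof.
have sum_first w s : \sum_(a <= k < (a + s.+1).+1) X k w =
    X a w + \sum_(a.+1 <= k < (a.+1 + s).+1) X k w.
  by rewrite big_ltn ?ltnS ?leq_addr // addSnnS.
apply/seteqP; split => w /=.
  move=> H; have := H 0%N isT; rewrite addn0 big_nat1 => Xx.
  exists `|x - X a w|%N => //.
  have -> : (`|x - X a w|%N)%:Z = x - X a w by lia.
  split => /=; first by lia.
  move=> s st; have := H s.+1 st.
  by rewrite sum_first -lerBrDl.
case=> i _ [/= Xa H] [_|s st]; first by rewrite addn0 big_nat1; lia.
by rewrite sum_first Xa -lerBrDl subKr; exact: H.
Qed.

Lemma stay_below_forever_rec a x :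
  stay_below_forever a x =
  \bigcup_i (X a @^-1` [set x - i%:Z] `&` stay_below_forever a.+1 i%:Z).
Proof.
apply/seteqP; split => w /=.
  move=> H; have := H 1%N I; rewrite stay_below_rec => -[i _ [/= Xa _]].
  exists i => //; split => // t _.
  (* The gap is determined by [X a w], so every horizon yields the same index. *)
  have := H t.+1 I; rewrite stay_below_rec => -[j _ [/= Xa' Hj]].
  by have -> : i%:Z = j%:Z by lia.
case=> i _ [/= Xa H] t _ s st.
suff : stay_below a t.+1 x w by apply; rewrite ltnS ltnW.
by rewrite stay_below_rec; exists i => //; split => //; exact: H.
Qed.

Lemma measurable_stay_below a t x : measurable (stay_below a t x).
Proof.
elim: t a x => [|t IH] a x.
  rewrite (_ : stay_below _ _ _ = setT) //; first by apply/seteqP; split.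
rewrite stay_below_rec; apply: bigcup_measurable => i _.
by apply: measurableI => //; exact: measurable_preimage.
Qed.

Lemma measurable_stay_below_forever a x : measurable (stay_below_forever a x).
Proof. by apply: bigcap_measurable => // t _; exact: measurable_stay_below. Qed.

Lemma stay_below_nonincreasing a x :
  {homo (stay_below a)^~ x : n m / (n <= m)%N >-> (m <= n)%O}.
Proof.
move=> n m nm; apply/subsetPset => w H s sn.
by apply: H; exact: leq_trans nm.
Qed.

Lemma cvg_stay_below a x :
  P (stay_below a t x) @[t --> \oo] --> P (stay_below_forever a x).
Proof.
apply: (@nonincreasing_cvg_mu _ _ _ P (fun t => stay_below a t x)).
- by rewrite (le_lt_trans (probability_le1 _ _)) ?ltry //;
     exact: measurable_stay_below.
- by move=> t; exact: measurable_stay_below.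
- exact: measurable_stay_below_forever.
- exact: stay_below_nonincreasing.
Qed.

Lemma trivIset_jump a x (F : nat -> set T) :
  trivIset setT (fun i : nat => X a @^-1` [set x - i%:Z] `&` F i).
Proof. by move=> i j _ _ [w /= [[Xi _] [Xj _]]]; lia. Qed.

Local Open Scope ereal_scope.

(** Under independence this is the probability of [stay_below a t x]; it involves only the laws of
    the single [X k], which is what periodicity controls. *)
Fixpoint stay_below_prob (a t : nat) (x : int) : \bar R :=
  if t is t'.+1 then
    \sum_(0 <= i <oo) P (X a @^-1` [set (x - i%:Z)%R]) *
      stay_below_prob a.+1 t' i%:Z
  else 1.

Lemma stay_below_prob_ge0 a t x : 0 <= stay_below_prob a t x.
Proof.
elim: t a x => [|t IH] a x //=.
by apply: nneseries_ge0 => i _ _; rewrite mule_ge0.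
Qed.

Hypothesis X_indep : mutually_independent [set k : nat | (1 <= k)%N] X.

(** The finite family of past events makes the induction on [t] go through: the first step from [a]
    joins that family, until at [t = 0] only the product formula of [X_indep] is left. *)
Lemma indep_stay_below (J : {fset nat}) (A : nat -> set int) a t x :
  (0 < a)%N -> (forall i, i \in J -> (0 < i < a)%N) ->
  P (\bigcap_(i in [set` J]) (X i @^-1` A i) `&` stay_below a t x) =
  (\prod_(i <- J) P (X i @^-1` A i)) * stay_below_prob a t x.
Proof.
elim: t a x J A => [|t IH] a x J A a0 Ja.
  rewrite (_ : stay_below _ _ _ = setT); last by apply/seteqP; split.
  by rewrite setIT mule1 X_indep // => i /Ja /andP[].
have aJ : a \notin J by apply/negP => /Ja /andP[_]; rewrite ltnn.
pose A' i := fun k => if k == a then [set (x - i%:Z)%R] else A k.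
have A'J i k : k \in J -> A' i k = A k.
  by move=> kJ; rewrite /A'; case: eqP kJ aJ => // -> ->.
have A'a i : A' i a = [set (x - i%:Z)%R] by rewrite /A' eqxx.
have mJ : measurable (\bigcap_(k in [set` J]) (X k @^-1` A k)).
  by apply: fin_bigcap_measurable => // k _; exact: measurable_preimage.
have mE i : measurable (\bigcap_(k in [set` J]) (X k @^-1` A k) `&`
    (X a @^-1` [set (x - i%:Z)%R] `&` stay_below a.+1 t i%:Z)).
  apply: measurableI => //; apply: measurableI; first exact: measurable_preimage.
  exact: measurable_stay_below.
rewrite stay_below_rec setI_bigcupr measure_semi_bigcup; last 3 first.
- by move=> i; exact: mE.
- by move=> i j _ _ [w /= [[_ [Xi _]] [_ [Xj _]]]]; lia.
- by apply: bigcup_measurable => i _; exact: mE.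
(* The product is finite; as a real constant it can be moved inside the series. *)
have <- : (fine (\prod_(k <- J) P (X k @^-1` A k)))%:E =
    \prod_(k <- J) P (X k @^-1` A k).
  by rewrite fineK // -X_indep ?fin_num_measure // => k /Ja /andP[].
rewrite -nneseriesZl; last by move=> i _; rewrite mule_ge0 // stay_below_prob_ge0.
apply: eq_eseriesr => i _.
rewrite fineK; last by rewrite -X_indep ?fin_num_measure // => k /Ja /andP[].
transitivity (P (\bigcap_(k in [set` (a |` J)%fset]) (X k @^-1` A' i k) `&`
    stay_below a.+1 t i%:Z)).
  congr (P _); apply/seteqP; split => w /=.
    move=> [HJ [Xa HG]]; split => // k /=; rewrite !inE => /orP[/eqP ->|kJ].
      by rewrite A'a.
    by rewrite A'J //; exact: HJ.
  move=> [HJ HG]; split; [|split => //].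
    by move=> k /= kJ; rewrite -(A'J i) //; apply: HJ; rewrite /= !inE kJ orbT.
  by have := HJ a; rewrite /= A'a; apply; rewrite !inE eqxx.
rewrite IH //; last first.
  move=> k; rewrite !inE => /orP[/eqP ->|/Ja /andP[k0 ka]]; first by rewrite a0 /=.
  by rewrite k0 ltnW.
rewrite big_fsetU1 //= A'a muleA; congr (_ * _).
rewrite muleC; congr (_ * _).
by rewrite !big_seq; apply: eq_bigr => k kJ; rewrite A'J.
Qed.

Lemma probability_stay_below a t x : (0 < a)%N ->
  P (stay_below a t x) = stay_below_prob a t x.
Proof.
move=> a0; have := @indep_stay_below fset0 (fun=> setT) a t x a0.
by rewrite big_seq_fset0 mul1e set_fset0 bigcap_set0 setTI; apply => i; rewrite inE.
Qed.

(** At each finite horizon this is the previous product formula with past [{a}]; continuity from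
    above takes both sides to the limit. *)
Lemma indep_stay_below_forever a (A : set int) x : (0 < a)%N ->
  P (X a @^-1` A `&` stay_below_forever a.+1 x) =
  P (X a @^-1` A) * P (stay_below_forever a.+1 x).
Proof.
move=> a0.
have fin B : measurable B -> P B \is a fin_num by exact: fin_num_measure.
have mA := measurable_preimage a A.
have E t : P (X a @^-1` A `&` stay_below a.+1 t x) =
           P (X a @^-1` A) * P (stay_below a.+1 t x).
  rewrite probability_stay_below //.
  have := @indep_stay_below [fset a]%fset (fun=> A) a.+1 t x isT.
  rewrite big_seq_fset1 set_fset1 bigcap_set1; apply => i; rewrite inE => /eqP ->.
  by rewrite a0 /=.
have H1 : P (X a @^-1` A `&` stay_below a.+1 t x) @[t --> \oo] -->
    P (X a @^-1` A `&` stay_below_forever a.+1 x).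
  rewrite /stay_below_forever -bigcapIr; last by exists 0%N.
  apply: (@nonincreasing_cvg_mu _ _ _ P (fun t => X a @^-1` A `&` stay_below a.+1 t x)).
  - rewrite (le_lt_trans (probability_le1 _ _)) ?ltry //.
    by apply: measurableI => //; exact: measurable_stay_below.
  - by move=> t; apply: measurableI => //; exact: measurable_stay_below.
  - apply: bigcap_measurable => // t _.
    by apply: measurableI => //; exact: measurable_stay_below.
  - move=> n m nm; apply/subsetPset; apply: setIS.
    by apply/subsetPset; exact: stay_below_nonincreasing.
have H2 : P (X a @^-1` A) * P (stay_below a.+1 t x) @[t --> \oo] -->
    P (X a @^-1` A) * P (stay_below_forever a.+1 x).
  apply: cvgeZl; first exact: fin.
  exact: cvg_stay_below.
apply: (cvg_unique _ H1); first exact: ereal_hausdorff.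
by rewrite (funext E).
Qed.

Lemma probability_stay_below_forever_rec a x : (0 < a)%N ->
  P (stay_below_forever a x) =
  \sum_(0 <= i <oo) P (X a @^-1` [set (x - i%:Z)%R]) *
    P (stay_below_forever a.+1 i%:Z).
Proof.
move=> a0; rewrite stay_below_forever_rec measure_semi_bigcup.
- by apply: eq_eseriesr => i _; exact: indep_stay_below_forever.
- move=> i; apply: measurableI; first exact: measurable_preimage.
  exact: measurable_stay_below_forever.
- exact: trivIset_jump.
- rewrite -stay_below_forever_rec; exact: measurable_stay_below_forever.
Qed.

End StayBelow.

(** * From the events to the distribution of the suprema, and the two finite sums *)

Section FiniteFormulas.
Context (d : measure_display) (T : measurableType d) (R : realType)
  (P : probability T R) (X : nat -> {RV P >-> int}).

Lemma ereal_sup_partial_sumsE j x :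
  [set w | (ereal_sup (partial_sums X j w) <= (x%:~R)%:E)%E] =
  stay_below_forever X j x.
Proof.
apply/seteqP; split => w /=.
  move=> le_x t _ s _; rewrite -(ler_int R) -lee_fin.
  apply: le_trans le_x; apply: ereal_sup_ubound.
  by exists (j + s)%N => //=; rewrite leq_addr.
move=> below; apply: ge_ereal_sup => _ [n /= jn <-].
rewrite lee_fin ler_int -(subnKC jn).
by apply: (below (n - j).+1 I).
Qed.

Lemma F_inftyE j x : F_infty X j x = fine (P (stay_below_forever X j x)).
Proof. by rewrite /F_infty ereal_sup_partial_sumsE. Qed.

(** The extra element [0] in the supremum defining [calM] respects any level [k >= 0]. *)
Lemma calM_le j (k : nat) w :
  (calM X j w <= (k%:R)%:E)%E <-> stay_below_forever X j k%:Z w.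
Proof.
rewrite -ereal_sup_partial_sumsE /= -pmulrn; split => [|le_k].
  by apply: le_trans; apply: ereal_sup_le; exact: subsetUr.
apply: ge_ereal_sup => y [/= ->|y_sum]; first by rewrite lee_fin.
by apply: le_trans le_k; exact: ereal_sup_ubound.
Qed.

Lemma calM_ge0 j w : (0 <= calM X j w)%E.
Proof. by apply: ereal_sup_ubound; left. Qed.

Lemma pi_mass0 j : pi_mass X j 0 = F_infty X j 0.
Proof.
rewrite F_inftyE /pi_mass; congr (fine (P _)); apply/seteqP; split => w /=.
  by move=> M0; apply/(calM_le j 0%N); rewrite M0.
by move=> /(calM_le j 0%N) M0; apply/eqP; rewrite eq_le M0 calM_ge0.
Qed.

Lemma pi_massS j k : pi_mass X j k.+1 = F_infty X j k.+1%:Z - F_infty X j k%:Z.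
Proof.
rewrite !F_inftyE /pi_mass.
have mS x := measurable_stay_below_forever X j x.
have fin A : measurable A -> P A \is a fin_num by exact: fin_num_measure.
have sub : stay_below_forever X j k%:Z `<=` stay_below_forever X j k.+1%:Z.
  by move=> w H t _ s st; apply: le_trans (H t I s st) _; rewrite lez_nat.
rewrite -fineB ?fin //.
rewrite -{1}(setIidr sub) -measureD //; last by rewrite ltey_eq fin.
congr (fine (P _)); apply/seteqP; split => w /=.
  move=> Mk; split; first by apply/calM_le; rewrite Mk.
  by move=> /calM_le; rewrite Mk lee_fin ler_nat ltnn.
move=> [/calM_le Mk /calM_le nMk]; apply/eqP; rewrite eq_le Mk /=.
(* Partial sums are integers: a supremum strictly below [k.+1] would bound each of them by [k],
   against [nMk]. *)
rewrite leNgt; apply/negP => Mlt; apply: nMk.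
apply: ge_ereal_sup => y [/= ->|]; first by rewrite lee_fin.
case=> n /= jn <-; rewrite lee_fin pmulrn ler_int -ltzD1 -PoszD addn1.
rewrite -(ltr_int R) -pmulrn -lte_fin.
apply: le_lt_trans Mlt; apply: ereal_sup_ubound; right.
by exists n.
Qed.

Lemma F_infty_sum_pi_mass j (k : nat) :
  F_infty X j k%:Z = \sum_(0 <= i < k.+1) pi_mass X j i.
Proof.
elim: k => [|k IH]; first by rewrite big_nat1 pi_mass0.
by rewrite big_nat_recr //= -IH pi_massS addrC subrK.
Qed.

Lemma dist_funB j x : dist_fun X j x = dist_fun X j (x - 1) + prob_mass X j x.
Proof.
have mX A : measurable [set w | A (X j w)] by exact: (measurable_preimage X j A).
rewrite /dist_fun /prob_mass -fineD; last 2 first.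
- exact/fin_num_measure/(mX [set k | k <= x - 1]).
- exact/fin_num_measure/(mX [set k | k = x]).
rewrite -measureU.
- by congr (fine (P _)); apply/seteqP; split => w /=; lia.
- exact: (mX [set k | k <= x - 1]).
- exact: (mX [set k | k = x]).
- by apply/seteqP; split => w //= -[]; lia.
Qed.

Variables (j : nat) (mj : int).
Hypothesis mj_start : P [set w | mj <= X j w] = 1%E.

Lemma prob_below_start (A : set int) : A `<=` [set k | k < mj] ->
  P (X j @^-1` A) = 0%E.
Proof.
move=> Alt; have mL : measurable [set w | mj <= X j w].
  exact: (measurable_preimage X j [set k | mj <= k]).
have PL : P (~` [set w | mj <= X j w]) = 0%E.
  by rewrite probability_setC // mj_start subee.
apply: (subset_measure0 _ _ _ PL); first exact: measurable_preimage.
- exact: measurableC.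
- by move=> w /Alt /=; lia.
Qed.

Lemma dist_fun_sum_prob_mass (n : nat) :
  dist_fun X j (mj + n%:Z) = \sum_(0 <= i < n.+1) prob_mass X j (mj + i%:Z).
Proof.
elim: n => [|n IH].
  rewrite big_nat1 dist_funB [X in X + _](_ : _ = 0) ?add0r //.
  by rewrite /dist_fun (prob_below_start (A := [set k | k <= _])) // => k /=; lia.
rewrite big_nat_recr //= -IH dist_funB; congr (dist_fun _ _ _ + _); lia.
Qed.

Hypothesis X_indep : mutually_independent [set k : nat | (1 <= k)%N] X.
Hypothesis j_gt0 : (0 < j)%N.

(** Every gap [i >= 0] would require [X j = x - i < mj], a null event. *)
Lemma F_infty_below_start x : x < mj -> F_infty X j x = 0.
Proof.
move=> x_lt; rewrite F_inftyE probability_stay_below_forever_rec // eseries0 //.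
move=> i _ _; rewrite (prob_below_start (A := [set _])) ?mul0e //.
by move=> _ /= ->; lia.
Qed.

(** The series over gaps stops at [n], since a gap [i > n] forces [X j] below [mj]. *)
Lemma F_infty_rec (n : nat) :
  F_infty X j (mj + n%:Z) =
  \sum_(0 <= i < n.+1) prob_mass X j (mj + n%:Z - i%:Z) * F_infty X j.+1 i%:Z.
Proof.
rewrite F_inftyE probability_stay_below_forever_rec //.
have fin A : measurable A -> P A \is a fin_num by exact: fin_num_measure.
have mS x := measurable_stay_below_forever X j.+1 x.
have mX A := measurable_preimage X j A.
rewrite (@nneseries_split _ _ 0 n.+1); last by move=> i _; rewrite mule_ge0.
rewrite add0n eseries0 ?adde0; last first.
  move=> i ni _; rewrite (prob_below_start (A := [set _])) ?mul0e //.
  by move=> _ /= ->; lia.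
rewrite -sum_fine; last by move=> i _; rewrite fin_numM ?fin.
by apply: eq_bigr => i _; rewrite fineM ?fin // F_inftyE.
Qed.

Lemma F_infty_fsum (n : int) :
  F_infty X j n =
  \sum_(k \in `[mj, n]) prob_mass X j k * F_infty X j.+1 (n - k).
Proof.
have [n_lt|mj_n] := ltP n mj.
  rewrite F_infty_below_start // [X in \sum_(k \in X) _](_ : _ = set0) ?fsbig_set0 //.
  by apply/seteqP; split => k //=; rewrite in_itv /=; lia.
pose r := `|n - mj|%N; have nE : n = mj + r%:Z by rewrite /r; lia.
(* The interval from [mj] to [n] is listed by decreasing step [k = n - i], that is by increasing gap
   [i]. *)
pose s := [seq n - i%:Z | i <- index_iota 0 r.+1].
have in_s k : (k \in s) = (mj <= k <= n).
  apply/mapP/idP => [[i]|/andP[mk kn]]; first by rewrite mem_index_iota => + ->; lia.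
  by exists `|n - k|%N; [rewrite mem_index_iota; lia | lia].
rewrite [X in \sum_(k \in X) _](_ : _ = [set` s]); last first.
  by apply/seteqP; split => k; rewrite /= in_s in_itv.
rewrite -fsbig_seq; last by rewrite map_inj_uniq ?iota_uniq // => i i'; lia.
rewrite big_map {1}nE F_infty_rec; apply: eq_bigr => i _.
by rewrite -nE subKr.
Qed.

(** With [F_infty X j.+1] at [i] written as a cumulative sum of [pi_mass], the double sum over
    [k <= i <= n] is exchanged; the inner sum over [i] then collects the masses of [X j] up to
    [mj + n - k]. *)
Lemma F_infty_sum_pi_dist (n : nat) :
  F_infty X j (n%:Z + mj) =
  \sum_(0 <= k < n.+1) pi_mass X j.+1 k * dist_fun X j (mj + n%:Z - k%:Z).
Proof.
rewrite addrC F_infty_rec.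
under eq_big_nat => i /andP[_ ilt].
  rewrite F_infty_sum_pi_mass mulr_sumr.
  (* A common range with the side condition [k < i.+1] makes the two sums exchangeable. *)
  rewrite (big_nat_widen _ _ n.+1) //.
  over.
rewrite (exchange_big_dep_nat xpredT) //=; apply: eq_big_nat => k /andP[_ kn].
rewrite -mulr_suml mulrC; congr (_ * _).
have -> : mj + n%:Z - k%:Z = mj + (n - k)%:Z by lia.
rewrite dist_fun_sum_prob_mass.
rewrite -(@big_nat_widenl _ _ _ k 0 n.+1 xpredT) //.
(* A shift by [k] and a reversal match decreasing steps with the increasing order used for
   [dist_fun]. *)
rewrite -{1}(add0n k) big_addn -subSn // big_nat_rev /=.
apply: eq_big_nat => i ilt; congr (prob_mass _ _ _); lia.
Qed.

End FiniteFormulas.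

(** * Invariance under a shift of the starting index by [N] *)

Section Periodicity.
Context (d : measure_display) (T : measurableType d) (R : realType)
  (P : probability T R) (X : nat -> {RV P >-> int}) (N : nat).
Hypothesis X_indep : mutually_independent [set k : nat | (1 <= k)%N] X.
Hypothesis X_periodic : forall k : nat, (1 <= k)%N ->
  forall A : set int, measurable A ->
    distribution P (X (k + N)%N) A = distribution P (X k) A.

Lemma stay_below_prob_periodic a t x : (0 < a)%N ->
  stay_below_prob X (a + N) t x = stay_below_prob X a t x.
Proof.
elim: t a x => [//|t IH] a x a0 /=; apply: eq_eseriesr => i _.
by rewrite -addSn IH //; congr (_ * _)%E; exact: X_periodic.
Qed.

(** The probabilities from [a + N] and from [a] agree at every finite horizon, hence so do their
    limits. *)
Lemma F_infty_periodic a x : (0 < a)%N -> F_infty X (a + N) x = F_infty X a x.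
Proof.
move=> a0; rewrite !F_inftyE; congr fine.
have PE t : P (stay_below X (a + N) t x) = P (stay_below X a t x).
  by rewrite !probability_stay_below ?addn_gt0 ?a0 // stay_below_prob_periodic.
apply: (cvg_unique _ (@cvg_stay_below _ _ _ _ X (a + N) x)).
  exact: ereal_hausdorff.
by rewrite (funext PE); exact: cvg_stay_below.
Qed.

Lemma pi_mass_periodic a k : (0 < a)%N -> pi_mass X (a + N) k = pi_mass X a k.
Proof.
by move=> a0; case: k => [|k]; rewrite ?pi_mass0 ?pi_massS !F_infty_periodic.
Qed.

End Periodicity.


Theorem proposition2 (d : measure_display) (T : measurableType d)
    (R : realType) (P : probability T R)
    (N : nat) (X : nat -> {RV P >-> int}) (m : nat -> int)
    (N_gt0 : (0 < N)%N)
    (X_indep : mutually_independent [set k : nat | (1 <= k)%N] X)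
    (X_periodic : forall k : nat, (1 <= k)%N ->
      forall A : set int, measurable A ->
        distribution P (X (k + N)%N) A = distribution P (X k) A)
    (m_periodic : forall i : nat, (1 <= i)%N -> m (i + N)%N = m i)
    (m_mass : forall j : nat, (1 <= j <= N)%N ->
      (0 < P [set w | X j w = m j])%E)
    (m_start : forall j : nat, (1 <= j <= N)%N ->
      P [set w | m j <= X j w] = 1%E)
    (m_sum : \sum_(1 <= j < N.+1) m j < 0) :
  [/\ forall x : int, F_infty X N.+1 x = F_infty X 1 x,
      forall k : nat, pi_mass X N.+1 k = pi_mass X 1 k,
      forall j : nat, (1 <= j <= N)%N ->
        forall n : int, M_bound N m j <= n ->
          F_infty X j n =
            \sum_(k \in `[m j, n]) prob_mass X j k * F_infty X j.+1 (n - k)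
    & forall j : nat, (1 <= j <= N)%N ->
        forall n : nat,
          F_infty X j (n%:Z + m j) =
            \sum_(0 <= k < n.+1)
              pi_mass X j.+1 k * dist_fun X j (m j + n%:Z - k%:Z)].
Proof.
split.
(* [N.+1] is read as [1 + N], one period after index 1. *)
- by move=> x; rewrite -add1n F_infty_periodic.
- by move=> k; rewrite -add1n pi_mass_periodic.
- move=> j jN n _; apply: F_infty_fsum => //; first exact: m_start.
  by case/andP: jN.
- move=> j jN n; apply: F_infty_sum_pi_dist => //; first exact: m_start.
  by case/andP: jN.
Qed.
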